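(* Let $\tau=(n_i)_{i\in I}$ be a type with $n_i>0$ for all $i\in I$, and let $Bij(\tau)$ be the set of all $\sigma\in Hyp(\tau)$ such that $\widehat{\sigma}:W_\tau(X)\to W_\tau(X)$ is a bijection. Then $(Bij(\tau);\circ_h,\varepsilon)$ is a submonoid of the monoid $(Hyp(\tau);\circ_h,\varepsilon)$.
   Context: Let $\Omega=\{f_i\mid i\in I\}$ be a set of operation symbols, where $f_i$ is $n_i$-ary. $W_\tau(X)$ is the set of all terms of type $\tau$ over the alphabet $X=\{x_1,x_2,\ldots\}$; terms in $W_\tau(X_n)$, with $X_n=\{x_1,\ldots,x_n\}$, $n\ge 1$, are called $n$-ary. For an $n$-ary term $t$ and terms $t_1,\ldots,t_n$, $S^n(t,t_1,\ldots,t_n)$ denotes the term obtained from $t$ by simultaneously substituting $t_k$ for $x_k$, $1\le k\le n$. A hypersubstitution of type $\tau$ is a mapping $\sigma:\Omega\to W_\tau(X)$ assigning to every $n_i$-ary operation symbol $f_i$ an $n_i$-ary term $\sigma(f_i)\in W_\tau(X_{n_i})$. $Hyp(\tau)$ is the set of all of them. Each $\sigma\in Hyp(\tau)$ induces $\widehat{\sigma}:W_\tau(X)\to W_\tau(X)$ by $\widehat{\sigma}[w]:=w$ for $w\in X$ and $\widehat{\sigma}[f_i(t_1,\ldots,t_{n_i})]:=S^{n_i}(\sigma(f_i),\widehat{\sigma}[t_1],\ldots,\widehat{\sigma}[t_{n_i}])$. The operation $\circ_h$ on $Hyp(\tau)$ is $\sigma_1\circ_h\sigma_2:=\widehat{\sigma}_1\circ\sigma_2$,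 where $\circ$ is the usual composition of mappings, and $\varepsilon$ is the hypersubstitution with $\varepsilon(f_i)=f_i(x_1,\ldots,x_{n_i})$ for all $i\in I$. $(Hyp(\tau);\circ_h,\varepsilon)$ is a monoid. *)

(* Defs.v *)
(* Mathematical Components, with the classical layer of MathComp-Analysis. *)
From HB Require Import structures.
From mathcomp Require Import all_boot.
From mathcomp Require Import boolp.

Set Implicit Arguments.
Unset Strict Implicit.
Unset Printing Implicit Defensive.

(* A type (n_i)_{i in I} is a function tau : I -> nat.  Variables are numbered
   from 0: [Var k] is x_{k+1}, and argument places are numbered likewise. *)
Inductive term (I : Type) (tau : I -> nat) : Type :=
| Var of nat
| App (i : I) of {ffun 'I_(tau i) -> term tau}.

Arguments Var {I tau}.
Arguments App {I tau}.

(* The automatically generated principle has no hypothesis on the arguments. *)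
Lemma term_nested_ind (I : Type) (tau : I -> nat) (P : term tau -> Prop) :
  (forall k, P (Var k)) ->
  (forall i (ts : {ffun 'I_(tau i) -> term tau}),
     (forall j, P (ts j)) -> P (App i ts)) ->
  forall t, P t.
Proof.
move=> PV PA; fix IH 1 => -[k|i ts]; first exact: PV.
by apply: PA => j; exact: IH.
Qed.

(* W_tau(X_n) as a predicate on W_tau(X) *)
Fixpoint nary (I : Type) (tau : I -> nat) (n : nat) (t : term tau) : bool :=
  match t with
  | Var k => k < n
  | App i ts => [forall j, nary n (ts j)]
  end.

(* S^n(t, t_1, ..., t_n).  It is only meant for n-ary t; it is made total by
   leaving the variables outside X_n unchanged. *)
Fixpoint superpose (I : Type) (tau : I -> nat) (n : nat) (t : term tau)
    (ts : 'I_n -> term tau) : term tau :=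
  match t with
  | Var k => if insub k is Some j then ts j else Var k
  | App i us => App i [ffun j => superpose (us j) ts]
  end.

Record hyp (I : Type) (tau : I -> nat) : Type := Hyp {
  hyp_fun :> I -> term tau;
  hyp_nary : forall i, nary (tau i) (hyp_fun i)
}.

Fixpoint hyp_ext (I : Type) (tau : I -> nat) (s : hyp tau) (t : term tau)
    : term tau :=
  match t with
  | Var k => Var k
  | App i ts => superpose (s i) (fun j => hyp_ext s (ts j))
  end.

Lemma nary_superpose (I : Type) (tau : I -> nat) (m n : nat) (t : term tau)
    (ts : 'I_n -> term tau) :
  nary n t -> (forall j, nary m (ts j)) -> nary m (superpose t ts).
Proof.
move=> + ts_m; elim/term_nested_ind: t => [k|i us IH] /=.
  by move=> k_n; rewrite insubT.
by move=> /forallP us_n; apply/forallP => j; rewrite ffunE; apply: IH.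
Qed.

Lemma nary_hyp_ext (I : Type) (tau : I -> nat) (s : hyp tau) (n : nat)
    (t : term tau) : nary n t -> nary n (hyp_ext s t).
Proof.
elim/term_nested_ind: t => [k|i ts IH] //= /forallP ts_n.
by apply: nary_superpose => [|j]; [exact: hyp_nary | exact: IH].
Qed.

Definition hyp_comp (I : Type) (tau : I -> nat) (s1 s2 : hyp tau) : hyp tau :=
  Hyp (fun i => nary_hyp_ext s1 (hyp_nary s2 i)).

Lemma nary_hyp_id (I : Type) (tau : I -> nat) (i : I) :
  nary (tau i) (App i [ffun j : 'I_(tau i) => Var j] : term tau).
Proof. by apply/forallP => j; rewrite ffunE /=. Qed.

Definition hyp_id (I : Type) (tau : I -> nat) : hyp tau :=
  Hyp (nary_hyp_id tau).

Lemma hyp_eq (I : Type) (tau : I -> nat) (s1 s2 : hyp tau) :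
  (forall i, s1 i = s2 i) -> s1 = s2.
Proof.
case: s1 s2 => [f1 h1] [f2 h2] /= /funext f12.
by case: f2 / f12 h2 => h2; congr Hyp; exact: Prop_irrelevance.
Qed.

Lemma superposeA (I : Type) (tau : I -> nat) (m n : nat) (t : term tau)
    (ts : 'I_n -> term tau) (us : 'I_m -> term tau) :
  nary n t ->
  superpose (superpose t ts) us = superpose t (fun j => superpose (ts j) us).
Proof.
elim/term_nested_ind: t => [k|i vs IH] /=; first by move=> k_n; rewrite insubT.
move=> /forallP vs_n; congr App; apply/ffunP => j.
by rewrite !ffunE; apply: IH.
Qed.

Lemma hyp_ext_superpose (I : Type) (tau : I -> nat) (s : hyp tau) (n : nat)
    (t : term tau) (ts : 'I_n -> term tau) :
  nary n t ->
  hyp_ext s (superpose t ts) =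
    superpose (hyp_ext s t) (fun j => hyp_ext s (ts j)).
Proof.
elim/term_nested_ind: t => [k|i us IH] /=; first by move=> k_n; rewrite insubT.
move=> /forallP us_n; rewrite superposeA; last exact: hyp_nary.
by congr superpose; apply/funext => j; rewrite ffunE IH.
Qed.

Fact hyp_compA (I : Type) (tau : I -> nat) : associative (@hyp_comp I tau).
Proof.
move=> s1 s2 s3; apply: hyp_eq => i /=.
elim/term_nested_ind: (s3 i) => [k|i' ts IH] //=.
rewrite hyp_ext_superpose; last exact: hyp_nary.
by congr superpose; apply/funext => j; exact: IH.
Qed.

Fact hyp_comp1s (I : Type) (tau : I -> nat) :
  left_id (hyp_id tau) (@hyp_comp I tau).
Proof.
move=> s; apply: hyp_eq => i /=.
elim/term_nested_ind: (s i) => [k|i' ts IH] //=.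
congr App; apply/ffunP => j; rewrite !ffunE /= insubT //= => j_lt.
by rewrite (_ : Sub _ _ = j) ?IH //; apply: val_inj.
Qed.

Fact hyp_comps1 (I : Type) (tau : I -> nat) :
  right_id (hyp_id tau) (@hyp_comp I tau).
Proof.
move=> s; apply: hyp_eq => i /=.
have := hyp_nary s i.
elim/term_nested_ind: (s i) => [k|i' ts IH] /=.
  by move=> k_n; rewrite insubT ffunE.
move=> /forallP ts_n; congr App; apply/ffunP => j.
by rewrite !ffunE; apply: IH.
Qed.

HB.instance Definition _ (I : Type) (tau : I -> nat) := gen_eqMixin (hyp tau).
HB.instance Definition _ (I : Type) (tau : I -> nat) :=
  gen_choiceMixin (hyp tau).
(* The monoid (Hyp(tau); o_h, epsilon) *)
HB.instance Definition _ (I : Type) (tau : I -> nat) :=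
  isMonoid.Build (hyp tau) (@hyp_compA I tau)
    (@hyp_comp1s I tau) (@hyp_comps1 I tau).

Definition Bij (I : Type) (tau : I -> nat) : {pred hyp tau} :=
  [pred s | `[< bijective (hyp_ext s) >]].

Arguments Bij {I} tau.

(* Main.v *)
Require Import Defs.
From mathcomp Require Import all_boot.
From mathcomp Require Import boolp.

(** Extension is a monoid homomorphism from hypersubstitutions to self-maps of the set of terms
    ([hyp_ext_comp], [hyp_ext_id]). [Bij tau] is the preimage of the bijections, which contain the
    identity and are closed under composition. *)

Lemma hyp_ext_comp (I : Type) (tau : I -> nat) (s1 s2 : hyp tau) :
  hyp_ext (hyp_comp s1 s2) =1 hyp_ext s1 \o hyp_ext s2.
Proof.
elim/term_nested_ind => [k|i ts IH] //=.
(* The extension of [s1] commutes with substitution into the [tau i]-ary term [s2 i]. *)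
rewrite hyp_ext_superpose; last exact: hyp_nary.
by congr superpose; apply/funext => j; exact: IH.
Qed.

Lemma hyp_ext_id (I : Type) (tau : I -> nat) : hyp_ext (hyp_id tau) =1 id.
Proof.
elim/term_nested_ind => [k|i ts IH] //=.
congr App; apply/ffunP => j; rewrite !ffunE /= insubT //= => j_lt.
by rewrite (_ : Sub _ _ = j) ?IH //; apply: val_inj.
Qed.

Theorem proposition1 (I : Type) (tau : I -> nat)
  (tau_gt0 : forall i : I, 0 < tau i) : monoid_closed (Bij tau).
Proof.
split=> [|s1 s2 /asboolP s1_bij /asboolP s2_bij]; apply/asboolP.
  by exists id => t; exact: hyp_ext_id.
apply: eq_bij (bij_comp s1_bij s2_bij) _ _ => t.
(* The monoid product unfolds to [hyp_comp] by conversion. *)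
by rewrite -[RHS]/(hyp_ext (hyp_comp s1 s2) t) hyp_ext_comp.
Qed.
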